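(* Let $p\geq 5$ be a prime and let $r$ be an integer with $1\leq r\leq p-1$ such that $24r+1$ is a quadratic nonresidue modulo $p$. Then for all $n\geq 0$, $d_{p-2}(pn+r)\equiv 0\pmod p$.
   Context: For each integer $k\geq 1$, the numbers $d_k(n)$ are defined by $\sum_{n\geq 0} d_k(n)q^n = \frac{f_2^k}{f_1^{3k+1}}$, where $f_r = \prod_{i\geq 1}(1-q^{ri})$. *)

(* Defs.v *)
From mathcomp Require Import all_boot all_order all_algebra.
Set Implicit Arguments. Unset Strict Implicit. Unset Printing Implicit Defensive.
Import GRing.Theory Num.Theory.
Local Open Scope ring_scope.

(* Coefficients of q-series are computed exactly via truncated polynomials:
   modulo q^(n+1), f_r = prod_{i>=1}(1 - q^{ri}) agrees with the finite product
   over 1 <= i <= n, and 1/(1 - q^i) agrees with sum_{j=0}^{n} q^{ij}. *)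

Definition f_trunc (r n : nat) : {poly int} :=
  \prod_(1 <= i < n.+1) (1 - 'X^(r * i)).

Definition inv_f1_trunc (n : nat) : {poly int} :=
  \prod_(1 <= i < n.+1) (\sum_(0 <= j < n.+1) 'X^(i * j)).

Definition d (k n : nat) : int :=
  ((f_trunc 2 n) ^+ k * (inv_f1_trunc n) ^+ (3 * k + 1))`_n.

(* a is a quadratic nonresidue modulo p: not congruent to any square
   (in particular a is not divisible by p). *)
Definition qnr (p a : nat) : Prop := ~ exists x : nat, (x ^ 2 = a %[mod p])%N.

(* Main.v *)
(* Modulo p, the generating series f_2^(p-2) / f_1^(3p-5) equals
   (f_2 / f_1^3)^p * (f_1^5 / f_2^2), whose first factor is a series in q^p by
   Frobenius.  Ramanujan's identity
     f_1^5 / f_2^2 = sum_(n in Z) (6n+1) q^(n(3n+1)/2)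
   and 24 * n(3n+1)/2 + 1 = (6n+1)^2 then confine the exponents to those N for
   which 24N+1 is a square modulo p.

   To prove Ramanujan's identity, three specializations of Jacobi's triple
   product give
     f_1 = sum_n (-1)^n q^(n(3n+1)/2),
     2 f_2^2 / f_1 = sum_k q^(k(k+1)/2),
     2 f_1^3 = sum_k (-1)^k (2k+1) q^(k(k+1)/2),
   and it remains to compare two sums over Z^2, namely
     sum ((6n+1) - (-1)^(n+k) (2k+1)) q^(n(3n+1)/2 + k(k+1)/2) = 0.
   With l = 6n+1 and j = 2k+1 the exponent is an affine function of the norm
   l^2 + 3j^2 of l + j sqrt(-3), and multiplying by a primitive cube root of unity
   or by its inverse, whichever keeps l and j odd, is an involution that changes
   the sign of the weight.

   Power series are replaced by elements of a commutative ring in which q is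
   nilpotent. *)
Require Import Defs.
From mathcomp Require Import all_boot all_order all_algebra.
From mathcomp Require Import zify ring.
Set Implicit Arguments. Unset Strict Implicit. Unset Printing Implicit Defensive.
Import Order.TTheory GRing.Theory.
Local Open Scope ring_scope.

(* [ring] fails on goals mixing several coercion paths from A to its ring
   structures, so the goal is first re-elaborated. *)
Ltac canon A x := lazymatch x with
  | Algebra.add ?a ?b =>
      let a' := canon A a in let b' := canon A b in constr:((a' + b')%R)
  | GRing.mul ?a ?b =>
      let a' := canon A a in let b' := canon A b in constr:((a' * b')%R)
  | Algebra.opp ?a => let a' := canon A a in constr:((- a')%R)
  | GRing.exp ?a ?n => let a' := canon A a in constr:((a' ^+ n)%R)
  | Algebra.natmul ?a ?n => let a' := canon A a in constr:((a' *+ n)%R)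
  | Algebra.zero => constr:(0%R : GRing.ComUnitRing.sort A)
  | GRing.one _ => constr:(1%R : GRing.ComUnitRing.sort A)
  | _ => constr:(x : GRing.ComUnitRing.sort A) end.
Ltac cring A := match goal with |- @eq _ ?x ?y =>
  let x' := canon A x in let y' := canon A y in change (x' = y'); ring end.

(** * Gaussian binomials and the finite triple product *)

Lemma binS2 j : 'C(j.+1, 2) = (j + 'C(j, 2))%N.
Proof. by rewrite binS bin1 addnC. Qed.

Section TripleProduct.
Variables (A : comUnitRingType) (Q : A).

Definition qfact n : A := \prod_(i < n) (1 - Q ^+ i.+1).

Lemma qfactS n : qfact n.+1 = qfact n * (1 - Q ^+ n.+1).
Proof. by rewrite /qfact big_ord_recr. Qed.

(* The Gaussian binomial coefficient [2m, m + j]. *)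
Definition central_qbin m j : A :=
  if (j <= m)%N then qfact m.*2 / (qfact (m - j) * qfact (m + j)) else 0.

Hypothesis unitQ : forall i, 1 - Q ^+ i.+1 \is a GRing.unit.

Lemma unit_qfact n : qfact n \is a GRing.unit.
Proof. by apply: rpred_prod => i _; apply: unitQ. Qed.

(** Oriented so that inverse factorials of nearby indices all reduce to the one of largest index,
    which leaves a polynomial identity. *)
Lemma qfactV n : (qfact n)^-1 = (qfact n.+1)^-1 * (1 - Q ^+ n.+1).
Proof.
by rewrite qfactS mulrC invrM ?unit_qfact ?unitQ // mulrA divrr ?unitQ // mul1r.
Qed.

Lemma central_qbinE m j : (j <= m)%N -> 
  central_qbin m j = qfact m.*2 * (qfact (m - j))^-1 * (qfact (m + j))^-1.
Proof.
by move=> jm; rewrite /central_qbin jm invrM ?unit_qfact // mulrA mulrAC.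
Qed.

Lemma central_qbin_out m j : (m < j)%N -> central_qbin m j = 0.
Proof. by rewrite ltnNge /central_qbin => /negbTE ->. Qed.

(** Two steps of the q-Pascal rule, from row 2m to row 2m + 2. *)
Lemma central_qbinS m j : (j <= m)%N ->
  central_qbin m.+1 j.+1 = (1 + Q ^+ m.*2.+1) * central_qbin m j.+1
    + Q ^+ (m - j) * central_qbin m j
    + Q ^+ (m + j.+2) * central_qbin m j.+2.
Proof.
move=> jm; have [k ->] : exists k, m = (j + k)%N by exists (m - j)%N; lia.
rewrite (@central_qbinE _.+1) ?ltnS ?leq_addr // doubleS.
rewrite !(qfactS _.+1) !(qfactS _.*2).
rewrite (@central_qbinE _ j) ?leq_addr //.
have -> : ((j + k).+1 - j.+1 = k)%N by lia.
have -> : ((j + k) - j = k)%N by lia.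
have -> : ((j + k).+1 + j.+1 = (j.*2 + k).+2)%N by lia.
have -> : ((j + k) + j = j.*2 + k)%N by lia.
rewrite (qfactV (j.*2 + k)) (qfactV (j.*2 + k).+1).
(* For k = 0 and k = 1 some entries lie beyond the end of row 2m and vanish. *)
case: k {jm} => [|[|k]].
- rewrite !central_qbin_out ?addn0 //; try lia.
  rewrite -addnn !exprS exprD; cring A.
- rewrite (@central_qbin_out _ j.+2) ?addn1 // central_qbinE //.
  have -> : (j.+1 - j.+1 = 0)%N by lia.
  have -> : (j.+1 + j.+1 = j.*2.+1.+1)%N by lia.
  rewrite (qfactV 0) (qfactV j.*2.+2) -!addnn !(addnS, addSn) !(exprS, exprD); cring A.
- rewrite !central_qbinE; try lia.
  have -> : (j + k.+2 - j.+1 = k.+1)%N by lia.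
  have -> : (j + k.+2 - j.+2 = k)%N by lia.
  have -> : (j + k.+2 + j.+1 = (j.*2 + k).+3)%N by lia.
  have -> : (j + k.+2 + j.+2 = (j.*2 + k).+4)%N by lia.
  rewrite (qfactV k) (qfactV k.+1) (qfactV (j.*2 + k).+3).
  rewrite -!addnn !(addnS, addSn) !(exprS, exprD).
  cring A.
Qed.

(** By symmetry the neighbours of index 1 and -1 agree, whence the doubled term. *)
Lemma central_qbinS0 m : central_qbin m.+1 0 =
  (1 + Q ^+ m.*2.+1) * central_qbin m 0 + Q ^+ m.+1 * central_qbin m 1 *+ 2.
Proof.
rewrite !(@central_qbinE _ 0) // !subn0 !addn0 doubleS (qfactS _.*2.+1) (qfactS _.*2).
case: m => [|m].
  by rewrite central_qbin_out // double0 !(qfactV 0); cring A.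
rewrite central_qbinE // subn1 addn1 /= !(qfactV m) !(qfactV m.+1).
by rewrite -!addnn !(addnS, addSn) !(exprS, exprD); cring A.
Qed.

(* The terms of index -j of the bilateral sum are written with v = Q / u, which
   avoids inverting u. *)
Lemma finite_triple_product (u v : A) m : u * v = Q ->
  \prod_(i < m) ((1 + u * Q ^+ i) * (1 + v * Q ^+ i)) = central_qbin m 0
    + \sum_(j < m) central_qbin m j.+1 * (Q ^+ 'C(j.+1, 2) * (u ^+ j.+1 + v ^+ j.+1)).
Proof.
(* [w j] joins the indices j and -j, so [w 0] is 2, twice the term of index 0. *)
move=> uvQ; pose w j := Q ^+ 'C(j, 2) * (u ^+ j + v ^+ j).
(* From uv = Q: (u + v)(u^(j+1) + v^(j+1)) = u^(j+2) + v^(j+2) + Q (u^j + v^j). *)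
have wS m' j : (j < m')%N ->
  Q ^+ m' * (u + v) * w j.+1 = Q ^+ (m' - j.+1) * w j.+2 + Q ^+ (m' + j.+1) * w j.
  move=> jm'; rewrite /w !binS2.
  have [k ->] : exists k, m' = (j + k).+1 by exists (m' - j.+1)%N; lia.
  have -> : ((j + k).+1 - j.+1 = k)%N by lia.
  by rewrite !(addnS, addSn, exprS, exprD) -uvQ; cring A.
elim: m => [|m IH].
  by rewrite !big_ord0 central_qbinE // /qfact !big_ord0 invr1 !mulr1 addr0.
rewrite big_ord_recr /= IH.
have -> : (1 + u * Q ^+ m) * (1 + v * Q ^+ m) =
    (1 + Q ^+ m.*2.+1) + Q ^+ m * (u + v).
  have -> : Q ^+ m.*2.+1 = u * v * (Q ^+ m * Q ^+ m) by rewrite -addnn exprS exprD uvQ.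
  by cring A.
pose c := central_qbin.
have sumS : \sum_(j < m.+1) c m.+1 j.+1 * w j.+1 =
    (1 + Q ^+ m.*2.+1) * (\sum_(j < m) c m j.+1 * w j.+1)
    + (Q ^+ m * c m 0 * w 1 + \sum_(j < m) Q ^+ (m - j.+1) * c m j.+1 * w j.+2)
    + \sum_(j < m) Q ^+ (m + j.+2) * c m j.+2 * w j.+1.
  pose a j := (1 + Q ^+ m.*2.+1) * (c m j.+1 * w j.+1).
  pose b j := Q ^+ (m - j) * c m j * w j.+1.
  pose e j := Q ^+ (m + j.+2) * c m j.+2 * w j.+1.
  transitivity (\sum_(j < m.+1) (a j + b j + e j)).
    apply: eq_bigr => j _; rewrite /c central_qbinS -1?ltnS // /a /b /e /c.
    by cring A.
  rewrite !big_split /= big_ord_recr big_ord_recl [in X in _ + X]big_ord_recr /=.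
  rewrite /a /b /e /c !(@central_qbin_out m _.+1) // subn0 big_distrr /=.
  by cring A.
have sumU : \sum_(j < m) Q ^+ (m + j.+1) * c m j.+1 * w j =
    Q ^+ m.+1 * c m 1 *+ 2 + \sum_(j < m) Q ^+ (m + j.+2) * c m j.+2 * w j.+1.
  case: (m) => [|k]; first by rewrite !big_ord0 /c central_qbin_out // mulr0 mul0rn addr0.
  rewrite big_ord_recl [in RHS]big_ord_recr /= /c (@central_qbin_out k.+1 k.+2) //.
  by rewrite /w !expr0 addn1; cring A.
rewrite -/(\sum_(j < m.+1) c m.+1 j.+1 * w j.+1) sumS central_qbinS0.
have sumP : (\sum_(j < m) c m j.+1 * w j.+1) * (Q ^+ m * (u + v)) =
   \sum_(j < m) Q ^+ (m - j.+1) * c m j.+1 * w j.+2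
   + \sum_(j < m) Q ^+ (m + j.+1) * c m j.+1 * w j.
  rewrite big_distrl -big_split /=; apply: eq_bigr => j _.
  by rewrite -mulrA [w _ * _]mulrC wS //; cring A.
rewrite mulrDr !mulrDl sumP sumU /w /c /= expr0 mul1r !expr1.
cring A.
Qed.

End TripleProduct.

(** * The triple product for nilpotent Q *)

Lemma unit_1subX_nilp (A : comUnitRingType) (Q : A) N i :
  Q ^+ N = 0 -> 1 - Q ^+ i.+1 \is a GRing.unit.
Proof.
move=> QN0; apply/unitrP; exists (\sum_(j < N) (Q ^+ i.+1) ^+ j).
have S1 : (1 - Q ^+ i.+1) * (\sum_(j < N) (Q ^+ i.+1) ^+ j) = 1.
  by rewrite -opprB mulNr -subrX1 exprAC QN0 expr0n add0r opprK.
by split; first rewrite mulrC.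
Qed.

Lemma nilp_exp (A : comUnitRingType) (Q : A) N n :
  Q ^+ N = 0 -> (N <= n)%N -> Q ^+ n = 0.
Proof. by move=> QN0 /subnKC <-; rewrite exprD QN0 mul0r. Qed.

(** Thus [qfact Q N] stands for the infinite product. *)
Lemma qfact_stable (A : comUnitRingType) (Q : A) N n :
  Q ^+ N = 0 -> (N <= n)%N -> qfact Q n = qfact Q N.
Proof.
move=> QN0 /subnKC <-; elim: (n - N)%N => [|k IH]; first by rewrite addn0.
by rewrite addnS qfactS (nilp_exp QN0) ?subr0 ?mulr1 // leqW ?leq_addr.
Qed.

(** In [finite_triple_product], the factorials are stable while m - j >= N, so each coefficient
    becomes 1; for larger j the power of Q vanishes. *)
Lemma triple_product (A : comUnitRingType) (Q u v : A) N m :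
  Q ^+ N = 0 -> (0 < N)%N -> (N.*2 <= m)%N -> u * v = Q ->
  qfact Q N * \prod_(i < m) ((1 + u * Q ^+ i) * (1 + v * Q ^+ i)) =
  1 + \sum_(j < m) Q ^+ 'C(j.+1, 2) * (u ^+ j.+1 + v ^+ j.+1).
Proof.
move=> QN0 N0 mN uvQ.
have uQ i : 1 - Q ^+ i.+1 \is a GRing.unit by apply: unit_1subX_nilp QN0.
have limc j : (N <= m - j)%N -> qfact Q N * central_qbin Q m j = 1.
  move=> jm; rewrite central_qbinE //; last lia.
  rewrite !(qfact_stable QN0); try lia.
  by rewrite divrr ?unit_qfact // mul1r divrr ?unit_qfact.
rewrite (finite_triple_product uQ m uvQ) mulrDr limc; last lia.
congr (_ + _); rewrite big_distrr /=; apply: eq_bigr => j _; rewrite mulrA.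
have [/limc ->|jm] := leqP N (m - j.+1); first by rewrite mul1r.
rewrite (nilp_exp QN0) ?mul0r ?mulr0 //.
have := ltn_ord j; rewrite binS2 => jm2.
by apply: (@leq_trans j); [lia | rewrite leq_addr].
Qed.

(** The factors are sorted by their exponent modulo 3. *)
Lemma qfact_cube (A : comUnitRingType) (q : A) m :
  qfact q (3 * m) =
  qfact (q ^+ 3) m *
  \prod_(i < m) ((1 + - q * (q ^+ 3) ^+ i) * (1 + - q ^+ 2 * (q ^+ 3) ^+ i)).
Proof.
elim: m => [|m IH]; first by rewrite muln0 /qfact !big_ord0 mulr1.
rewrite mulnS add3n !qfactS IH big_ord_recr /= -!exprM mulnS add3n !exprS.
by cring A.
Qed.

Lemma qfact_square (A : comUnitRingType) (q : A) m :
  qfact (q ^+ 2) m = qfact q m * \prod_(i < m) (1 + q ^+ i.+1).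
Proof.
rewrite /qfact -big_split /=; apply: eq_bigr => i _.
by rewrite -exprM mulnC exprM; cring A.
Qed.

(** * Bilateral sums, pentagonal and triangular exponents *)

Fixpoint zrange (B : nat) : seq int :=
  if B is B'.+1 then B'.+1%:Z :: - B'.+1%:Z :: zrange B' else [:: 0].

Lemma mem_zrange B n : (n \in zrange B) = (`|n| <= B)%N.
Proof.
elim: B => [|B IH]; first by rewrite inE; lia.
by rewrite !inE IH; lia.
Qed.

Lemma zrange_uniq B : uniq (zrange B).
Proof.
by elim: B => [|B IH] //=; rewrite inE !mem_zrange IH andbT; lia.
Qed.

Lemma big_zrange (A : zmodType) B (F : int -> A) :
  \sum_(n <- zrange B) F n = F 0 + \sum_(j < B) (F j.+1%:Z + F (- j.+1%:Z)).
Proof.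
elim: B => [|B IH]; first by rewrite big_seq1 big_ord0 addr0.
by rewrite !big_cons IH big_ord_recr /= addrA addrC -addrA.
Qed.

(** Both numerators are even and nonnegative at every integer, so neither the division nor the
    absolute value loses anything. *)
Definition pent (n : int) : nat := `|(n * (3 * n + 1) %/ 2)%Z|.
Definition tri (n : int) : nat := `|(n * (n + 1) %/ 2)%Z|.

Lemma int_parity (n : int) : (exists k : int, n = 2 * k) \/ exists k : int, n = 2 * k + 1.
Proof.
have : n = 2 * (n %/ 2)%Z \/ n = 2 * (n %/ 2)%Z + 1 by lia.
by case=> ->; [left|right]; eexists.
Qed.
Lemma absz_half (a b : int) : 0 <= b -> a = b * 2 -> `|(a %/ 2)%Z|%N%:Z * 2 = a.
Proof. by move=> b0 ->; rewrite mulzK // gez0_abs. Qed.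

Lemma triE n : (tri n)%:Z * 2 = n * (n + 1).
Proof.
case: (int_parity n) => [[k ->]|[k ->]].
  by apply: (@absz_half _ (k * (2 * k + 1))); [case: (leP 0 k) => ?; nia | ring].
by apply: (@absz_half _ ((2 * k + 1) * (k + 1))); [case: (leP 0 k) => ?; nia | ring].
Qed.

Lemma pentE n : (pent n)%:Z * 2 = n * (3 * n + 1).
Proof.
case: (int_parity n) => [[k ->]|[k ->]].
  by apply: (@absz_half _ (k * (6 * k + 1))); [case: (leP 0 k) => ?; nia | ring].
by apply: (@absz_half _ ((2 * k + 1) * (3 * k + 2))); [case: (leP 0 k) => ?; nia | ring].
Qed.

Lemma bin2E j : ('C(j, 2))%:Z * 2 = j%:Z * (j%:Z - 1).
Proof. by elim: j => [|j IH] //; rewrite binS2; lia. Qed.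

Lemma pent_pos j : pent j.+1%:Z = (3 * 'C(j.+1, 2) + 2 * j.+1)%N.
Proof. by have := pentE j.+1%:Z; have := bin2E j.+1; lia. Qed.

Lemma pent_neg j : pent (- j.+1%:Z) = (3 * 'C(j.+1, 2) + j.+1)%N.
Proof. by have := pentE (- j.+1%:Z); have := bin2E j.+1; lia. Qed.

Lemma tri_pos j : tri j.+1%:Z = ('C(j.+1, 2) + j.+1)%N.
Proof. by have := triE j.+1%:Z; have := bin2E j.+1; lia. Qed.

Lemma tri_neg j : tri (- j.+1%:Z) = 'C(j.+1, 2).
Proof. by have := triE (- j.+1%:Z); have := bin2E j.+1; lia. Qed.

(** * Three specializations of the triple product *)

Section Thetas.
Variables (A : comUnitRingType) (q : A) (K m : nat).
Hypotheses (qK0 : q ^+ K = 0) (K_gt0 : (0 < K)%N) (Km : (K.*2 <= m)%N).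

(** Triple product with base q^3 at u = -q, v = -q^2. *)
Lemma euler_pentagonal :
  \sum_(n <- zrange m) (-1) ^+ `|n|%N * q ^+ pent n = qfact q K.
Proof.
have q3K : (q ^+ 3) ^+ K = 0 by rewrite exprAC qK0 expr0n.
rewrite -(@qfact_stable _ q K (3 * m)) //; last lia.
rewrite qfact_cube (@qfact_stable _ (q ^+ 3) K) //; last lia.
have uv : - q * - q ^+ 2 = q ^+ 3 by cring A.
rewrite (triple_product q3K) // big_zrange mulr1.
congr (_ + _); apply: eq_bigr => j _.
rewrite pent_pos pent_neg abszN absz_nat; move: (j.+1 : nat) 'C(j.+1, 2) => k c.
rewrite (exprD q (3 * c) (2 * k)) (exprD q (3 * c) k) !(exprM q 3) (exprM q 2).
rewrite (exprNn q) (exprNn (q ^+ 2)).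
by cring A.
Qed.

(** Triple product at u = 1, v = q; the factor 2 is 1 + u at i = 0. *)
Lemma gauss_triangular :
  qfact q K * \sum_(k <- zrange m) q ^+ tri k = qfact (q ^+ 2) K ^+ 2 *+ 2.
Proof.
have q2K : (q ^+ 2) ^+ K = 0 by rewrite exprAC qK0 expr0n.
have -> : \sum_(k <- zrange m) q ^+ tri k =
    1 + \sum_(j < m) q ^+ 'C(j.+1, 2) * (1 ^+ j.+1 + q ^+ j.+1).
  rewrite big_zrange; congr (_ + _); apply: eq_bigr => j _.
  by rewrite tri_pos tri_neg exprD expr1n mulrDr mulr1 addrC.
rewrite -(@triple_product _ q 1 q K) ?mul1r //.
rewrite -(@qfact_stable _ (q ^+ 2) K m) //; last lia.
rewrite qfact_square (@qfact_stable _ q K m) //; last lia.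
have shift : \prod_(i < m) (1 + 1 * q ^+ i) = \prod_(i < m) (1 + q ^+ i.+1) *+ 2.
  transitivity (\prod_(i < m.+1) (1 + q ^+ i)).
    rewrite big_ord_recr /= (nilp_exp qK0); last lia.
    by rewrite addr0 mulr1; apply: eq_bigr => i _; rewrite mul1r.
  by rewrite big_ord_recl expr0 mulrDl mul1r mulr2n.
rewrite big_split /= shift.
under [X in _ *+ 2 * X]eq_bigr do rewrite -exprS.
by cring A.
Qed.

(* First-order expansion of the triple product at u = -1: u = -(1 - eps),
   v = -q(1 + eps). *)
Lemma jacobi_cube eps : eps ^+ 2 = 0 ->
  eps * \sum_(k <- zrange m) (-1) ^+ `|k|%N * (2 * k + 1)%:~R * q ^+ tri k =
  eps * qfact q K ^+ 3 *+ 2.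
Proof.
move=> eps2.
pose t j := (-1) ^+ j.+1 * q ^+ 'C(j.+1, 2).
(* At u = -1, v = -q the product contains 1 + u = 0. *)
have zero : 1 + \sum_(j < m) t j * (1 + q ^+ j.+1) = 0.
  have uv : - 1 * - q = q by cring A.
  transitivity (1 + \sum_(j < m) q ^+ 'C(j.+1, 2) * ((-1) ^+ j.+1 + (-q) ^+ j.+1)).
    congr (_ + _); apply: eq_bigr => j _.
    by rewrite /t (exprNn q); cring A.
  rewrite -(triple_product qK0) //; case: (m) Km => [|m' _]; first lia.
  by rewrite big_ord_recl expr0 mulr1 subrr !mul0r mulr0.
have onep n (x : A) : x ^+ 2 = 0 -> (1 + x) ^+ n = 1 + x *+ n.
  move=> x2; elim: n => [|n IH]; first by rewrite expr0 mulr0n addr0.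
  rewrite exprS IH mulrDl mul1r mulrDr mulr1 mulrnAr -expr2 x2 mul0rn addr0.
  by rewrite mulrS -addrA [x *+ n + _]addrC.
have uv : - (1 - eps) * (- q * (1 + eps)) = q.
  transitivity (q - q * eps ^+ 2); first by cring A.
  by rewrite eps2 mulr0 subr0.
have eps_prod n (f g : nat -> A) : (forall i, eps * f i = eps * g i) ->
    eps * \prod_(i < n) f i = eps * \prod_(i < n) g i.
  move=> fg; elim: n => [|n IH]; first by rewrite !big_ord0.
  by rewrite !big_ord_recr /= mulrA IH mulrAC fg mulrAC mulrA.
(* [D] is the coefficient of eps on the sum side; the weights 2k + 1 give twice [D] plus the sum
   that vanishes by [zero]. *)
pose D := \sum_(j < m) t j * (q ^+ j.+1 - 1) *+ j.+1.
have -> : \sum_(k <- zrange m) (-1) ^+ `|k|%N * (2 * k + 1)%:~R * q ^+ tri k = D *+ 2.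
  transitivity (1 + \sum_(j < m) t j * (1 + q ^+ j.+1) + D *+ 2); last first.
    by rewrite zero add0r.
  rewrite big_zrange -addrA; congr (_ + _).
    by rewrite mulr0 add0r /tri mul0r div0z !mulr1.
  rewrite -sumrMnl -big_split /=; apply: eq_bigr => j _.
  rewrite tri_pos tri_neg /t.
  have -> : (2 * j.+1%:Z + 1)%:~R = j.+1%:R *+ 2 + 1 :> A.
    by rewrite mulr_natl intrD rmorphMn /=.
  have -> : (2 * - j.+1%:Z + 1)%:~R = - (j.+1%:R *+ 2) + 1 :> A.
    by rewrite mulr_natl intrD rmorphMn rmorphN mulNrn /=.
  rewrite exprD -(mulr_natr _ j.+1); cring A.
have := triple_product qK0 K_gt0 Km uv.
have -> : \prod_(i < m) ((1 + - (1 - eps) * q ^+ i) * (1 + - q * (1 + eps) * q ^+ i)) =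
    eps * (qfact q K) ^+ 2.
  rewrite big_split /=.
  (* The factor at i = 0 is eps, which erases eps from all the others since eps^2 = 0. *)
  have -> : \prod_(i < m) (1 + - (1 - eps) * q ^+ i) = eps * qfact q K.
    case: (m) Km => [|m' m'K]; first lia.
    rewrite big_ord_recl expr0 mulr1 subKr.
    rewrite -(@qfact_stable _ q K m') //; last lia.
    apply: (eps_prod m' (fun i => 1 + - (1 - eps) * q ^+ i.+1)
      (fun i => 1 - q ^+ i.+1)) => i.
    transitivity (eps * (1 - q ^+ i.+1) + eps ^+ 2 * q ^+ i.+1); first by cring A.
    by rewrite eps2 mul0r addr0.
  rewrite mulrAC -(@qfact_stable _ q K m) //; last lia.
  rewrite (eps_prod m (fun i => 1 + - q * (1 + eps) * q ^+ i) (fun i => 1 - q ^+ i.+1)).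
    by rewrite -/(qfact q m); cring A.
  move=> i; transitivity (eps * (1 - q ^+ i.+1) - eps ^+ 2 * q ^+ i.+1).
    by rewrite exprS; cring A.
  by rewrite eps2 mul0r subr0.
have -> : 1 + \sum_(j < m) q ^+ 'C(j.+1, 2) *
      ((- (1 - eps)) ^+ j.+1 + (- q * (1 + eps)) ^+ j.+1) = eps * D.
  transitivity (1 + \sum_(j < m) t j * (1 + q ^+ j.+1) + eps * D); last first.
    by rewrite zero add0r.
  rewrite -addrA; congr (_ + _).
  rewrite big_distrr -big_split /=; apply: eq_bigr => j _.
  rewrite (exprNn (1 - eps)) exprMn (exprNn q) !onep ?sqrrN //.
  rewrite /t -[eps *+ _]mulr_natr -[- eps *+ _]mulr_natr -[_ * _ *+ _]mulr_natr.
  move: (q ^+ 'C(_, _)) (q ^+ j.+1) ((-1) ^+ j.+1) (j.+1%:R) => a b c e.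
  by cring A.
move=> eD; transitivity (qfact q K * (eps * qfact q K ^+ 2) *+ 2); last by cring A.
by rewrite eD; cring A.
Qed.
End Thetas.

(** * The sign-reversing rotation and the lattice sum *)

(* Multiplication of (6n+1) + (2k+1) sqrt(-3) by a primitive cube root of unity or
   by its inverse; the parity of n + k decides which of the two keeps both
   coordinates odd. *)
Definition rot120 (x : int * int) : int * int :=
  let: (n, k) := x in
  if odd (`|n| + `|k|) then (- ((n + k + 1) %/ 2)%Z, ((3 * n - k - 1) %/ 2)%Z)
  else (((k - n) %/ 2)%Z, ((- 3 * n - k - 2) %/ 2)%Z).

(** With l = 6n+1 and j = 2k+1, the norm l^2 + 3j^2 is 24 [energy] + 4. *)
Definition energy (x : int * int) : nat := (pent x.1 + tri x.2)%N.

(** Weight of (n, k) in the difference of the two theta products to be compared. *)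
Definition defect (x : int * int) : int :=
  (6 * x.1 + 1) - (-1) ^+ (`|x.1| + `|x.2|) * (2 * x.2 + 1).

Lemma energyE x :
  (energy x)%:Z * 2 = x.1 * (3 * x.1 + 1) + x.2 * (x.2 + 1).
Proof. by rewrite /energy PoszD mulrDl pentE triE. Qed.

(** Division-free coordinates: each (n, s) yields one point of either parity class, and the rotation
    swaps the two. *)
Variant rot120_spec : int * int -> int * int -> Prop :=
| Rot120Even n s : rot120_spec (n, n + 2 * s) (s, - 2 * n - s - 1)
| Rot120Odd n s : rot120_spec (s, - 2 * n - s - 1) (n, n + 2 * s).

Lemma odd_type_even (n s : int) : odd (`|n| + `|(n + 2 * s)%R|) = false.
Proof. lia. Qed.

Lemma odd_type_odd (n s : int) : odd (`|s| + `|(- 2 * n - s - 1)%R|) = true.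
Proof. lia. Qed.

Lemma rot120P x : rot120_spec x (rot120 x).
Proof.
case: x => n k; rewrite /rot120; case: ifP => onk.
  have [t [-> -> ->]] : exists t, [/\ k = - 2 * t - n - 1,
      - ((n + k + 1) %/ 2)%Z = t & ((3 * n - k - 1) %/ 2)%Z = t + 2 * n].
    by exists (- ((n + k + 1) %/ 2)%Z); split; lia.
  exact: (Rot120Odd t n).
have [s [-> -> ->]] : exists s, [/\ k = n + 2 * s,
    ((k - n) %/ 2)%Z = s & ((- 3 * n - k - 2) %/ 2)%Z = - 2 * n - s - 1].
  by exists ((k - n) %/ 2)%Z; split; lia.
exact: (Rot120Even n s).
Qed.

Lemma rot120K : involutive rot120.
Proof.
move=> x; case: (rot120P x) => n s; rewrite /rot120 ?odd_type_even ?odd_type_odd.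
  by congr pair; lia.
by congr pair; lia.
Qed.

Lemma energy_rot120 x : energy (rot120 x) = energy x.
Proof.
have := energyE x; have := energyE (rot120 x).
by case: (rot120P x) => n s /=; nia.
Qed.

Lemma defect_rot120 x : defect (rot120 x) = - defect x.
Proof.
case: (rot120P x) => n s; rewrite /defect /= -!(signr_odd _ (_ + _)) odd_type_even odd_type_odd.
  by rewrite expr0 expr1; ring.
by rewrite expr0 expr1; ring.
Qed.

Section LatticeSum.
Variables (A : comUnitRingType) (q : A) (K m : nat).
Hypotheses (qK0 : q ^+ K = 0) (Km : (K <= m)%N).

Lemma lattice_sum :
  (\sum_(x <- [seq (n, k) | n <- zrange m, k <- zrange m])
    (defect x)%:~R * q ^+ energy x) *+ 2 = 0.
Proof.
pose F x := (defect x)%:~R * q ^+ energy x : A.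
(* The box is not stable under [rot120], but its points of energy below K are, and the other terms
   vanish. *)
set s := flatten _; pose D := [seq x <- s | (energy x < K)%N].
have memD x : (x \in D) = (energy x < K)%N.
  rewrite mem_filter andbC; case: x => n k /=.
  have [e|] := ltnP (energy (n, k)) K; rewrite ?andbF //.
  rewrite andbT; apply/allpairsP; exists (n, k); split => //=; rewrite mem_zrange.
    have := pentE n; move: e; rewrite /energy /=; nia.
  have := triE k; move: e; rewrite /energy /=; nia.
have uD : uniq D.
  by rewrite filter_uniq // allpairs_uniq ?zrange_uniq //= => -[? ?] [? ?].
have eD : \sum_(x <- s) F x = \sum_(x <- D) F x.
  rewrite big_filter [RHS]big_mkcond /=; apply: eq_bigr => x _.
  by case: ltnP => // eK; rewrite /F (nilp_exp qK0) ?mulr0.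
rewrite [\sum_(x <- s) _]eD mulr2n.
rewrite -[X in X + _](perm_big _ (_ : perm_eq (map rot120 D) D)).
  rewrite big_map -big_split /= big1 // => x _.
  by rewrite /F energy_rot120 defect_rot120 rmorphN mulNr addNr.
apply: uniq_perm => //; first by rewrite map_inj_uniq //; apply: inv_inj rot120K.
move=> x; apply/mapP/idP => [[y yD ->]|xD]; first by rewrite memD energy_rot120 -memD.
by exists (rot120 x); rewrite ?rot120K // memD energy_rot120 -memD.
Qed.
End LatticeSum.

(** * Ramanujan's identity modulo the annihilator of eps *)

Section CongruenceModAnnihilator.
Variables (A : comUnitRingType) (eps : A).

Lemma ann_exp x y n : eps * x = eps * y -> eps * x ^+ n = eps * y ^+ n.
Proof.
move=> xy; elim: n => [|n IH]; first by rewrite !expr0.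
by rewrite !exprS mulrA xy mulrAC IH mulrAC mulrA.
Qed.

Lemma ann_prod1 n (f : nat -> A) :
  (forall i, (i < n)%N -> eps * f i = eps) -> eps * \prod_(i < n) f i = eps.
Proof.
elim: n => [|n IH] f1; first by rewrite big_ord0 mulr1.
by rewrite big_ord_recr /= mulrA IH ?f1 // => i /ltnW; apply: f1.
Qed.

Lemma ann_qfact Q n k :
  eps * Q ^+ n.+1 = 0 -> (n <= k)%N -> eps * qfact Q k = eps * qfact Q n.
Proof.
move=> eQ /subnKC <-; elim: (k - n)%N => [|j IH]; first by rewrite addn0.
rewrite addnS qfactS mulrA IH mulrBr mulr1 -addSn exprD.
by rewrite mulrACA eQ mul0r subr0.
Qed.

End CongruenceModAnnihilator.

(** The chain 2 eps G f_2^2 = eps f_1 G T = eps f_1 E J = eps f_1^2 J = 2 eps f_1^5, after which 2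
    is cancelled; eps is inherited from [jacobi_cube]. *)
Lemma qfact_pow5_series (A : comUnitRingType) (q eps : A) K m :
  q ^+ K = 0 -> (0 < K)%N -> (K.*2 <= m)%N -> eps ^+ 2 = 0 ->
  (2%:R : A) \is a GRing.unit ->
  eps * (\sum_(n <- zrange m) (6 * n + 1)%:~R * q ^+ pent n)
      * qfact (q ^+ 2) K ^+ 2 = eps * qfact q K ^+ 5.
Proof.
move=> qK0 K0 Km eps2 u2.
set G := \sum_(n <- _) _.
pose T := \sum_(k <- zrange m) q ^+ tri k.
pose E := \sum_(n <- zrange m) (-1) ^+ `|n|%N * q ^+ pent n.
pose J := \sum_(k <- zrange m) (-1) ^+ `|k|%N * (2 * k + 1)%:~R * q ^+ tri k.
have reg2 (x y : A) : x *+ 2 = y *+ 2 -> x = y.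
  by rewrite -(mulr_natr x) -(mulr_natr y); apply: mulIr.
have GT : G * T = E * J.
  apply/eqP; rewrite -subr_eq0; apply/eqP/reg2; rewrite mul0rn.
  rewrite -[RHS](@lattice_sum A q K m) //; last lia.
  congr (_ *+ 2); rewrite big_allpairs /= !big_distrl -sumrB /=.
  apply: eq_bigr => n _; rewrite !big_distrr -sumrB /=; apply: eq_bigr => k _.
  rewrite /defect /energy /= intrB intrM rmorphXn /= rmorphN1 !exprD.
  by cring A.
have EP : E = qfact q K by apply: euler_pentagonal.
have TP : qfact q K * T = qfact (q ^+ 2) K ^+ 2 *+ 2 by apply: gauss_triangular.
have JP : eps * J = eps * qfact q K ^+ 3 *+ 2 by apply: jacobi_cube.
apply: reg2.
transitivity (eps * G * (qfact q K * T)); first by rewrite TP; cring A.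
transitivity (eps * qfact q K * (G * T)); first by cring A.
rewrite GT EP; transitivity (eps * J * qfact q K ^+ 2); first by cring A.
by rewrite JP; cring A.
Qed.

(** * Transfer to truncated polynomials in characteristic p *)

Lemma in_qpoly_eq_coef (F : fieldType) K (f g : {poly F}) i :
  (i < K)%N -> in_qpoly 'X^K f = in_qpoly 'X^K g -> f`_i = g`_i.
Proof.
move=> iK fg; have K0 : (0 < K)%N by lia.
have coefr (h : {poly F}) : (in_qpoly 'X^K h : {poly F})`_i = h`_i.
  rewrite {2}(Pdiv.RingMonic.rdivp_eq (monicXn F K) h) coefD coefMXn iK add0r /=.
  by rewrite mk_monic_Xn prednK.
by rewrite -(coefr f) -(coefr g) fg.
Qed.

(** By Frobenius, H^p is a combination of the powers X^(pj). *)
Lemma coef_exp_pchar (F : fieldType) p (H : {poly F}) i :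
  p \in [pchar F] -> ~~ (p %| i)%N -> (H ^+ p)`_i = 0.
Proof.
move=> pF; have pP : p \in [pchar {poly F}] by rewrite pchar_poly.
move=> pi; rewrite -(coefK H) poly_def -(pFrobenius_autE pP) rmorph_sum coef_sum big1 //=.
move=> j _; rewrite pFrobenius_autE exprZn -exprM coefZ coefXn.
by case: eqP pi => [->|]; rewrite ?mulr0 // dvdn_mull.
Qed.

Section Reduction.
Variable F : fieldType.
Implicit Types (n N : nat).

Lemma map_f_trunc r N :
  map_poly intr (f_trunc r N) = \prod_(i < N) (1 - 'X^(r * i.+1)) :> {poly F}.
Proof.
rewrite /f_trunc big_add1 /= big_mkord rmorph_prod; apply: eq_bigr => i _.
by rewrite rmorphB rmorph1 /= map_polyXn.
Qed.

Lemma map_inv_f1_trunc N :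
  map_poly intr (inv_f1_trunc N) =
  \prod_(i < N) (\sum_(j < N.+1) 'X^(i.+1 * j)) :> {poly F}.
Proof.
rewrite /inv_f1_trunc big_add1 /= big_mkord rmorph_prod; apply: eq_bigr => i _.
by rewrite big_mkord rmorph_sum; apply: eq_bigr => j _; rewrite /= map_polyXn.
Qed.

(** Each geometric sum telescopes; the result is 1 modulo X^(N+1), enough precision for the
    coefficient of index N. *)
Lemma f1_inv N :
  (\prod_(i < N) (1 - 'X^(1 * i.+1))) * (\prod_(i < N) (\sum_(j < N.+1) 'X^(i.+1 * j)))
  = \prod_(i < N) (1 - 'X^(N.+1 * i.+1)) :> {poly F}.
Proof.
rewrite -big_split /=; apply: eq_bigr => i _; rewrite mul1n.
under eq_bigr do rewrite exprM.
by rewrite -opprB mulNr -subrX1 opprB -exprM mulnC.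
Qed.

(* In F[X]/(X^(2M)) the element eps = X^M has square zero, and x, y agree below
   degree M exactly when eps * x = eps * y. *)
Lemma coef_d_mod p N : p \in [pchar F] -> (5 <= p)%N ->
  exists H : {poly F}, (d (p - 2) N)%:~R =
   (H ^+ p * \sum_(n <- zrange (4 * N.+1)) (6 * n + 1)%:~R *: 'X^(pent n))`_N.
Proof.
move=> pF p5; pose M := N.+1; pose K := M.*2.
pose A := {poly %/ ('X^K : {poly F})}.
pose phi : {rmorphism {poly F} -> A} := in_qpoly 'X^K.
pose f1 : {poly F} := \prod_(i < N) (1 - 'X^(1 * i.+1)).
pose f2 : {poly F} := \prod_(i < N) (1 - 'X^(2 * i.+1)).
pose iv : {poly F} := \prod_(i < N) (\sum_(j < N.+1) 'X^(i.+1 * j)).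
(* [iv] stands for 1/f_1, so this witness is f_2 / f_1^3. *)
exists (f2 * iv ^+ 3); set G := \sum_(n <- _) _.
have -> : (d (p - 2) N)%:~R = (f2 ^+ (p - 2) * iv ^+ (3 * (p - 2) + 1))`_N.
  rewrite /d -coef_map rmorphM !rmorphXn /=.
  by rewrite map_f_trunc map_inv_f1_trunc.
pose q : A := phi 'X; pose eps := q ^+ M.
have phiX n : phi 'X^n = q ^+ n by rewrite rmorphXn.
have qK0 : q ^+ K = 0.
  rewrite -phiX; apply: val_inj => /=.
  by rewrite mk_monic_Xn prednK // Pdiv.RingMonic.rmodpp // monicXn.
have eps2 : eps ^+ 2 = 0 by rewrite -exprM muln2.
have epsq n : (M <= n)%N -> eps * q ^+ n = 0.
  by move=> Mn; rewrite -exprD (nilp_exp qK0) // /K; lia.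
have u2 : (2%:R : A) \is a GRing.unit.
  apply/unitrP; exists (phi (2^-1)%:P).
  have e2 : phi (2^-1)%:P * 2 = 1.
    rewrite -(rmorph_nat phi 2) -rmorphM -polyC_natr -polyCM mulVf ?rmorph1 //.
    by rewrite -(dvdn_pcharf pF); apply: contraL p5 => /dvdn_leq; lia.
  by split=> //; rewrite mulrC.
have phiG : phi G = \sum_(n <- zrange (4 * M)) (6 * n + 1)%:~R * q ^+ pent n.
  rewrite rmorph_sum; apply: eq_bigr => n _.
  by rewrite -mul_polyC rmorphM /= phiX !rmorph_int.
have := qfact_pow5_series qK0 (_ : 0 < K)%N (_ : K.*2 <= 4 * M)%N eps2 u2.
rewrite -phiG => /(_ isT); have -> : (K.*2 <= 4 * M)%N by rewrite /K; lia.
move=> /(_ isT) main.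
have f1E : phi f1 = qfact q N.
  by rewrite rmorph_prod; apply: eq_bigr => i _; rewrite rmorphB rmorph1 phiX mul1n.
have f2E : phi f2 = qfact (q ^+ 2) N.
  by rewrite rmorph_prod; apply: eq_bigr => i _; rewrite rmorphB rmorph1 phiX exprM.
have uf2 : phi f2 \is a GRing.unit.
  rewrite f2E; apply: unit_qfact => i; apply: (@unit_1subX_nilp _ _ K).
  by rewrite exprAC qK0 expr0n.
have bc : eps * (phi f1 * phi iv) = eps.
  rewrite -rmorphM f1_inv rmorph_prod.
  apply: (ann_prod1 (f := fun i => phi (1 - 'X^(N.+1 * i.+1)))) => i _.
  by rewrite rmorphB rmorph1 phiX mulrBr mulr1 epsq ?subr0 // leq_pmulr.
(* Truncation is lowered from K to N: under eps, every factor 1 - q^i with i > N acts as 1. *)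
have {}main : eps * phi G * phi f2 ^+ 2 = eps * phi f1 ^+ 5.
  rewrite f1E f2E -(ann_exp 5 (ann_qfact (epsq M _) (_ : N <= K)%N)) //; last first.
    by rewrite /K /M; lia.
  rewrite -main mulrAC [in RHS]mulrAC; congr (_ * _).
  apply: ann_exp; rewrite (@ann_qfact _ _ _ N K) //; last by rewrite /K /M; lia.
  by rewrite -exprM epsq // /M; lia.
(* The factor X^M supplies eps; reading the coefficient of index M + N < K removes it again. *)
have eqX : phi ('X^M * (f2 ^+ (p - 2) * iv ^+ (3 * (p - 2) + 1))) =
    phi ('X^M * ((f2 * iv ^+ 3) ^+ p * G)).
  rewrite !(rmorphM, rmorphXn) /= -/eps.
  have -> : p = (p - 2).+2 by lia.
  move: (p - 2)%N => k; rewrite !subSS subn0.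
  have bc5 : eps * (phi f1 * phi iv) ^+ 5 = eps.
    by rewrite (@ann_exp _ _ _ 1) ?expr1n ?mulr1.
  (* Times f_2^2, both sides equal eps f_1^5 f_2^p iv^(3p): the left through the inserted (f_1
     iv)^5, the right through [main]. *)
  apply: (mulIr (unitrX 2 uf2)).
  transitivity (eps * (phi f1 * phi iv) ^+ 5 *
      (phi f2 ^+ k.+2 * phi iv ^+ (3 * k + 1))).
    by rewrite bc5 !exprS; cring A.
  transitivity (eps * phi G * phi f2 ^+ 2 * (phi f2 * phi iv ^+ 3) ^+ k.+2).
    rewrite main exprMn exprMn -!exprM mulnS mulnS exprD !exprS.
    by rewrite [in RHS]exprD exprD; cring A.
  by cring A.
have MNK : (M + N < K)%N by rewrite /K /M; lia.
have := in_qpoly_eq_coef MNK eqX.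
by rewrite !coefXnM [(_ < M)%N]ltnNge leq_addr /= addKn.
Qed.

End Reduction.

Theorem theorem4p1 (p r : nat) :
  prime p -> (5 <= p)%N -> (1 <= r <= p - 1)%N -> qnr p (24 * r + 1) ->
  forall n : nat, ((p%:Z) %| d (p - 2) (p * n + r))%Z.
Proof.
move=> p_pr p5 _ rqnr n.
have pF := pchar_Fp p_pr.
have [H dE] := coef_d_mod (p * n + r) pF p5.
rewrite (dvdz_pcharf pF) dE mulr_sumr coef_sum big1 // => k _.
rewrite -scalerAr coefZ coefMXn; case: ltnP => [|le_k]; rewrite ?mulr0 //.
(* A surviving term would have [pent k] congruent to r modulo p, making 24r + 1 congruent to
   (6k+1)^2. *)
rewrite coef_exp_pchar ?mulr0 //; apply/negP => /dvdnP[m mE].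
apply: rqnr; exists `|(6 * k + 1)%R|%N.
have -> : (`|(6 * k + 1)%R|%N ^ 2 = 24 * pent k + 1)%N.
  by have := pentE k; rewrite -mulnn; nia.
rewrite -(modnMDl (24 * m)) -(modnMDl (24 * n) (24 * r + 1)); congr (_ %% _)%N; nia.
Qed.
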